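(* Let $m$ be a nonnegative integer, and let $\alpha$ be a complex number. Then $$(-1)^{m}\frac{\pi^{2m+2}}{4(2m+1)!}\left((\alpha-1)^{2m+1}-(\alpha+1)^{2m+1}\right)+\sum_{k=0}^m(-1)^{k}\left((\alpha-1)^{2k}+(\alpha+1)^{2k}+2\alpha^{2k}\right)\frac{\pi^{2k}}{(2k)!}\,\lambda(2m-2k+2)=0,$$ where $0^0=1$.
   Context: The Dirichlet lambda function is $\lambda(s)=\sum_{n=0}^\infty\frac{1}{(2n+1)^s}$ for $\mathrm{Re}(s)>1$. *)

(* Defs.v *)
From Stdlib Require Import Reals.
From Coquelicot Require Import Coquelicot.

Open Scope C_scope.

Definition Cexp (z : C) : C :=
  RtoC (exp (Re z)) * (RtoC (cos (Im z)) + Ci * RtoC (sin (Im z))).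

(** [x ^ s] with the real logarithm; meaningful for [0 < x] only. *)
Definition RCpower (x : R) (s : C) : C := Cexp (s * RtoC (ln x)).

Definition lambda_term (s : C) (n : nat) : C :=
  / RCpower (2 * INR n + 1)%R s.

(** The operator [lim] is total, so [lambda s] has no meaning when the series
    diverges; see [lambda_unique]. *)
Definition lambda (s : C) : C :=
  lim (T := C_CompleteNormedModule)
      (filtermap (sum_n (lambda_term s)) eventually).

Lemma lambda_unique (s l : C) : is_series (lambda_term s) l -> lambda s = l.
Proof.
intros H.
apply (filterlim_locally_unique (V := C_NormedModule)
         (F := eventually) (sum_n (lambda_term s))); [ | exact H ].
apply filterlim_locally; intros eps.
assert (HP : ProperFilter (filtermap (sum_n (lambda_term s)) eventually))
  by (apply filtermap_proper_filter; apply eventually_filter).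
apply (complete_cauchy (T := C_CompleteNormedModule) _ HP).
intros e.
exists l.
apply (H (ball l e)).
apply (locally_ball l e).
Qed.

(* Main.v *)
Require Import Defs.
From Stdlib Require Import Reals Factorial Lra Lia.
From Coquelicot Require Import Coquelicot.

(** Let C_j(t) be the sum of cos((2n+1)t) / (2n+1)^(2j+2) over n >= 0.  It takes
    the value lambda(2j+2) at t = 0 and -lambda(2j+2) at t = pi, and
    C_{j+1}'' = - C_j.  The first of these functions is linear:
    C_0(t) = pi/4 * (pi/2 - t) on [0, pi], because the sine series - C_0' is the
    Fourier series of a square wave, with the value pi/4 on ]0, pi[.  Integrating
    twice, with C_{j+1}'(0) = 0, shows that C_j is a polynomial on [0, pi] whose
    even coefficients are values of lambda and which has one further term, of
    degree 2j+1 ([lim_cos_sum]).  Evaluation at pi gives a linear recurrence for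
    the numbers lambda(2j+2) ([Rlambda_recurrence]), and up to a factor 2 this
    recurrence is the identity for alpha = 0.

    The general case follows by algebra: by the binomial theorem, the left side
    for m and alpha is the sum over i <= m of
    (-1)^i (pi alpha)^(2i) / (2i)! times the left side for m - i and 0
    ([identity_from_value_at_0]).

    The convergence is controlled without exchanging limits and derivatives:
    everything is done with the partial sums and explicit error bounds.  For C_0
    the closed form of the Dirichlet kernel shows that the sine sums converge at
    rate 1/K away from the end points ([sin_sum_near_PI2]), the value pi/4 of the
    limit being that of Leibniz' series; the end points are reached by uniform
    convergence ([Rlambda_0]).  For the induction step the partial sums of C_j
    differ from C_j by at most the remainder of lambda(2j+2), uniformly in t. *)

Open Scope R_scope.

(** * Real sums, limits and increments *)

(** An equation whose left side is a [sum_n] lives in the carrier of an abstract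
    monoid; [ring] and [field] need to see the concrete type. *)
Ltac real_eq := lazymatch goal with |- @eq _ ?a ?b => change (@eq R a b) end.

Lemma Rsum_Sn (a : nat -> R) n : sum_n a (S n) = sum_n a n + a (S n).
Proof. exact (sum_Sn a n). Qed.

Lemma Rsum_opp (a : nat -> R) n : sum_n (fun k => - a k) n = - sum_n a n.
Proof.
induction n as [|n IH]; [now rewrite !sum_O | ].
rewrite !Rsum_Sn, IH; real_eq; ring.
Qed.

Lemma Rsum_Sn_first (a : nat -> R) n :
  sum_n a (S n) = a O + sum_n (fun k => a (S k)) n.
Proof.
induction n as [|n IH]; [now rewrite Rsum_Sn, !sum_O | ].
rewrite Rsum_Sn, IH, Rsum_Sn; real_eq; ring.
Qed.

Lemma increment_le (f df : R -> R) (D a b : R) :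
  a <= b ->
  (forall u, a <= u <= b -> is_derive f u (df u) /\ Rabs (df u) <= D) ->
  Rabs (f b - f a) <= D * (b - a).
Proof.
intros Hab H.
destruct (MVT_gen f a b df) as [c [Hc ->]].
- rewrite Rmin_left, Rmax_right by exact Hab; intros u Hu; apply H; lra.
- rewrite Rmin_left, Rmax_right by exact Hab; intros u Hu.
  apply continuity_pt_filterlim.
  apply (ex_derive_continuous f); exists (df u); apply H; lra.
- rewrite Rmin_left, Rmax_right in Hc by exact Hab.
  rewrite Rabs_mult, (Rabs_right (b - a)) by lra.
  apply Rmult_le_compat_r; [lra | apply H; lra].
Qed.

(** Two applications of the mean value inequality: since [f1] vanishes at 0, a
    bound on [f2] bounds [f1] by [D * u], and this in turn bounds the increment
    of [f]. *)
Lemma increment_le_second (f f1 f2 : R -> R) (D b : R) :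
  0 <= b -> f1 0 = 0 ->
  (forall u, 0 <= u <= b -> is_derive f u (f1 u)) ->
  (forall u, 0 <= u <= b -> is_derive f1 u (f2 u) /\ Rabs (f2 u) <= D) ->
  Rabs (f b - f 0) <= D * b ^ 2.
Proof.
intros Hb H0 H1 H2.
replace (D * b ^ 2) with (D * b * (b - 0)) by ring.
assert (HD : 0 <= D).
{ destruct (H2 b) as [_ HD]; [lra | ].
  exact (Rle_trans _ _ _ (Rabs_pos _) HD). }
apply increment_le with f1; [exact Hb | ].
intros u Hu; split; [now apply H1 | ].
apply Rle_trans with (D * (u - 0)).
- rewrite <- (Rminus_0_r (f1 u)), <- H0 at 1.
  apply increment_le with f2; [lra | ].
  intros v Hv; apply H2; lra.
- apply Rmult_le_compat_l; lra.
Qed.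

Lemma is_lim_seq_squeeze_abs (u v : nat -> R) (l : R) :
  (forall n, Rabs (u n - l) <= v n) -> is_lim_seq v 0 -> is_lim_seq u l.
Proof.
intros Huv Hv.
apply (is_lim_seq_le_le (fun n => l - v n) u (fun n => l + v n)).
- intros n; specialize (Huv n); apply Rabs_le_between in Huv; lra.
- replace (Finite l) with (Finite (l - 0)) by (apply Rbar_finite_eq; ring).
  apply is_lim_seq_minus'; [apply is_lim_seq_const | exact Hv].
- replace (Finite l) with (Finite (l + 0)) by (apply Rbar_finite_eq; ring).
  apply is_lim_seq_plus'; [apply is_lim_seq_const | exact Hv].
Qed.

Lemma lim_const_div_INR c d : is_lim_seq (fun n => c / (INR n + d)) 0.
Proof.
replace (Finite 0) with (Rbar_mult c 0) by (apply Rbar_finite_eq; ring).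
apply (is_lim_seq_scal_l (fun n => / (INR n + d)) c 0).
change (Finite 0) with (Rbar_inv p_infty).
apply is_lim_seq_inv; [ | discriminate].
apply (is_lim_seq_plus _ _ p_infty d); [ | | reflexivity].
- apply is_lim_seq_INR.
- apply is_lim_seq_const.
Qed.

(** The quantitative form of the Weierstrass test.  Its right side depends on the
    majorant only, so that it bounds the remainder of a trigonometric series at
    all points at once. *)
Lemma partial_sum_tail_le (a b : nat -> R) K :
  (forall n, Rabs (b n) <= a n) -> ex_series a ->
  Rabs (sum_n b K - Series b) <= Series a - sum_n a K.
Proof.
intros Hle Ha.
assert (Hb : ex_series b) by (apply (ex_series_le b a); [exact Hle | exact Ha]).
assert (Ha' : ex_series (fun k => a (S K + k)%nat))
  by (apply (ex_series_incr_n a); exact Ha).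
rewrite (Series_incr_n a (S K)) by (lia || assumption).
rewrite (Series_incr_n b (S K)) by (lia || assumption).
rewrite <- !sum_n_Reals; simpl Init.Nat.pred.
replace (sum_n b K - _) with (- Series (fun k => b (S K + k)%nat)) by ring.
rewrite Rabs_Ropp.
replace (_ + _ - sum_n a K) with (Series (fun k => a (S K + k)%nat)) by ring.
apply Rle_trans with (Series (fun k => Rabs (b (S K + k)%nat))).
- apply Series_Rabs.
  apply (ex_series_le (fun k => Rabs (b (S K + k)%nat)) (fun k => a (S K + k)%nat)).
  + intros n; change (Rabs (Rabs (b (S K + n)%nat)) <= a (S K + n)%nat).
    rewrite Rabs_Rabsolu; apply Hle.
  + exact Ha'.
- apply Series_le; [ | exact Ha'].
  intros n; split; [apply Rabs_pos | apply Hle].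
Qed.

(** * Even values of lambda and trigonometric sums over odd frequencies *)

Definition odd_num (n : nat) : R := 2 * INR n + 1.

Lemma odd_num_ge1 n : 1 <= odd_num n.
Proof. unfold odd_num; pose proof (pos_INR n); lra. Qed.

Lemma odd_num_pow_gt0 n p : 0 < odd_num n ^ p.
Proof. apply pow_lt; pose proof (odd_num_ge1 n); lra. Qed.

(** The number lambda(2j+2), as a real number. *)
Definition Rlambda (j : nat) : R := Series (fun n => / odd_num n ^ (2 * j + 2)).

Lemma sum_inv_consecutive N :
  sum_n (fun n => 2 * / ((INR n + 1) * (INR n + 2))) N = 2 - 2 / (INR N + 2).
Proof.
induction N as [|N IH].
- rewrite sum_O; simpl; field.
- rewrite Rsum_Sn, IH, S_INR; pose proof (pos_INR N); real_eq; field; lra.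
Qed.

(** All these series are dominated by a telescoping one, because
    [2 * (2n+1)^2 >= (n+1) * (n+2)]. *)
Lemma ex_series_lambda j : ex_series (fun n => / odd_num n ^ (2 * j + 2)).
Proof.
apply (ex_series_le (fun n => / odd_num n ^ (2 * j + 2))
         (fun n => 2 * / ((INR n + 1) * (INR n + 2)))).
- intros n.
  change (Rabs (/ odd_num n ^ (2 * j + 2)) <= 2 * / ((INR n + 1) * (INR n + 2))).
  pose proof (pos_INR n) as Hn; pose proof (odd_num_ge1 n) as Ho.
  rewrite Rabs_right by (apply Rle_ge, Rlt_le, Rinv_0_lt_compat, odd_num_pow_gt0).
  apply Rle_trans with (/ odd_num n ^ 2).
  + apply Rinv_le_contravar; [apply odd_num_pow_gt0 | apply Rle_pow; [exact Ho | lia]].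
  + replace (2 * / ((INR n + 1) * (INR n + 2)))
      with (/ (((INR n + 1) * (INR n + 2)) / 2)) by (field; lra).
    apply Rinv_le_contravar; unfold odd_num; nra.
- exists 2.
  change (is_lim_seq (sum_n (fun n => 2 * / ((INR n + 1) * (INR n + 2)))) 2).
  apply (is_lim_seq_ext (fun N => 2 - 2 / (INR N + 2))).
  + intros N; symmetry; apply sum_inv_consecutive.
  + replace (Finite 2) with (Rbar_minus 2 0) by (apply Rbar_finite_eq; ring).
    apply is_lim_seq_minus'; [apply is_lim_seq_const | apply lim_const_div_INR].
Qed.

Definition cos_sum (p K : nat) (t : R) : R :=
  sum_n (fun n => cos (odd_num n * t) / odd_num n ^ p) K.

Definition sin_sum (p K : nat) (t : R) : R :=
  sum_n (fun n => sin (odd_num n * t) / odd_num n ^ p) K.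

Lemma is_derive_cos_sum p K t : is_derive (cos_sum (S p) K) t (- sin_sum p K t).
Proof.
unfold sin_sum; rewrite <- Rsum_opp.
apply (is_derive_sum_n (V := R_NormedModule)
  (fun n t => cos (odd_num n * t) / odd_num n ^ S p)).
intros n _; pose proof (odd_num_ge1 n); pose proof (odd_num_pow_gt0 n p).
auto_derive; [trivial | simpl pow; field; lra].
Qed.

Lemma is_derive_sin_sum p K t : is_derive (sin_sum (S p) K) t (cos_sum p K t).
Proof.
apply (is_derive_sum_n (V := R_NormedModule)
  (fun n t => sin (odd_num n * t) / odd_num n ^ S p)).
intros n _; pose proof (odd_num_ge1 n); pose proof (odd_num_pow_gt0 n p).
auto_derive; [trivial | simpl pow; field; lra].
Qed.

Lemma sin_sum_at_0 p K : sin_sum p K 0 = 0.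
Proof.
unfold sin_sum.
rewrite (sum_n_ext _ (fun _ => 0)).
- rewrite sum_n_const; real_eq; ring.
- intros n; rewrite Rmult_0_r, sin_0; unfold Rdiv; real_eq; ring.
Qed.

(** The remainder of the series of lambda(2j+2), which by [cos_sum_tail_le] bounds
    that of the cosine series with the same coefficients at every point. *)
Definition lambda_tail (j K : nat) : R :=
  Rlambda j - sum_n (fun n => / odd_num n ^ (2 * j + 2)) K.

Lemma lim_lambda_tail j : is_lim_seq (lambda_tail j) 0.
Proof.
replace (Finite 0) with (Rbar_minus (Rlambda j) (Rlambda j))
  by (apply Rbar_finite_eq; ring).
apply is_lim_seq_minus'; [apply is_lim_seq_const | ].
exact (Series_correct _ (ex_series_lambda j)).
Qed.

Lemma cos_sum_tail_le j K t (l : R) :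
  is_lim_seq (fun N => cos_sum (2 * j + 2) N t) l ->
  Rabs (cos_sum (2 * j + 2) K t - l) <= lambda_tail j K.
Proof.
intros Hl.
replace l with (Series (fun n => cos (odd_num n * t) / odd_num n ^ (2 * j + 2))).
- apply partial_sum_tail_le; [ | apply ex_series_lambda].
  intros n; pose proof (odd_num_pow_gt0 n (2 * j + 2)) as Hp.
  unfold Rdiv; rewrite Rabs_mult, (Rabs_right (/ _))
    by (apply Rle_ge, Rlt_le, Rinv_0_lt_compat, Hp).
  rewrite <- (Rmult_1_l (/ odd_num n ^ (2 * j + 2))) at 2.
  apply Rmult_le_compat_r; [apply Rlt_le, Rinv_0_lt_compat, Hp | ].
  apply Rabs_le, COS_bound.
- exact (is_series_unique _ _ Hl).
Qed.

Lemma cos_sum_at_0 j K : cos_sum (2 * j + 2) K 0 = Rlambda j - lambda_tail j K.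
Proof.
unfold lambda_tail, cos_sum, Rminus; rewrite Ropp_plus_distr, Ropp_involutive.
rewrite <- Rplus_assoc, Rplus_opp_r, Rplus_0_l.
apply sum_n_ext; intros n; rewrite Rmult_0_r, cos_0; unfold Rdiv; real_eq; ring.
Qed.

Lemma sin_odd_PI2 n : sin (odd_num n * (PI / 2)) = (-1) ^ n.
Proof.
unfold odd_num; induction n as [|n IH].
- simpl; rewrite Rmult_0_r, Rplus_0_l, Rmult_1_l; exact sin_PI2.
- rewrite S_INR.
  replace ((2 * (INR n + 1) + 1) * (PI / 2))
    with ((2 * INR n + 1) * (PI / 2) + PI) by field.
  rewrite neg_sin, IH; simpl; ring.
Qed.

Lemma cos_odd_PI2 n : cos (odd_num n * (PI / 2)) = 0.
Proof.
unfold odd_num; induction n as [|n IH].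
- simpl; rewrite Rmult_0_r, Rplus_0_l, Rmult_1_l; exact cos_PI2.
- rewrite S_INR.
  replace ((2 * (INR n + 1) + 1) * (PI / 2))
    with ((2 * INR n + 1) * (PI / 2) + PI) by field.
  rewrite neg_cos, IH; ring.
Qed.

Lemma cos_odd_PI n : cos (odd_num n * PI) = -1.
Proof.
replace (odd_num n * PI) with (PI + 2 * INR n * PI) by (unfold odd_num; ring).
rewrite cos_period; exact cos_PI.
Qed.

Lemma cos_sum_at_PI2 p K : cos_sum p K (PI / 2) = 0.
Proof.
unfold cos_sum.
transitivity (sum_n (fun _ => 0) K); [ | rewrite sum_n_const; real_eq; ring].
apply sum_n_ext; intros n; rewrite cos_odd_PI2; unfold Rdiv; real_eq; ring.
Qed.

Lemma cos_sum_at_PI p K : cos_sum p K PI = - cos_sum p K 0.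
Proof.
unfold cos_sum; rewrite <- Rsum_opp.
apply sum_n_ext; intros n; rewrite cos_odd_PI, Rmult_0_r, cos_0.
unfold Rdiv; real_eq; ring.
Qed.

(** * The cosine series with coefficients 1/(2n+1)^2 *)

(** Induction on [K], where [2 sin t cos x = sin (x + t) - sin (x - t)] makes the
    sum telescope. *)
Lemma dirichlet_kernel K t :
  2 * sin t * cos_sum 0 K t = sin (2 * INR (S K) * t).
Proof.
unfold cos_sum; induction K as [|K IH].
- rewrite sum_O; unfold odd_num; simpl.
  replace ((2 * 0 + 1) * t) with t by ring.
  replace (2 * 1 * t) with (2 * t) by ring; rewrite sin_2a; field.
- rewrite Rsum_Sn, Rmult_plus_distr_l, IH; unfold odd_num.
  rewrite (S_INR (S K)).
  set (x := (2 * INR (S K) + 1) * t).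
  replace (2 * INR (S K) * t) with (x - t) by (unfold x; ring).
  replace (2 * (INR (S K) + 1) * t) with (x + t) by (unfold x; ring).
  rewrite sin_plus, sin_minus; simpl pow; field.
Qed.

(** At [PI / 2] the sine series is Leibniz' alternating series. *)
Lemma lim_sin_sum_PI2 : is_lim_seq (fun K => sin_sum 1 K (PI / 2)) (PI / 4).
Proof.
assert (H4 : is_lim_seq (fun N => sum_f_R0 (tg_alt PI_tg) N) (Alt_PI / 4)).
{ apply is_lim_seq_Reals.
  unfold Alt_PI; destruct exist_PI as [l Hl].
  replace (4 * l / 4) with l by field; exact Hl. }
rewrite Alt_PI_eq in H4.
apply is_lim_seq_ext with (2 := H4); intros K.
rewrite <- sum_n_Reals; apply sum_n_ext; intros n.
rewrite sin_odd_PI2; unfold tg_alt, PI_tg, odd_num.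
rewrite plus_INR, mult_INR, pow_1; reflexivity.
Qed.

(** The sine is the cosine of the distance to [PI / 2], and this turns every
    bound at [t] into a bound on the symmetric interval around [PI / 2] that
    ends at [t]. *)
Lemma sin_le_of_closer_to_PI2 t u :
  0 < t < PI -> Rabs (u - PI / 2) <= Rabs (t - PI / 2) -> sin t <= sin u.
Proof.
intros Ht Hu.
assert (Hs : forall x, sin x = cos (Rabs (x - PI / 2))).
{ intros x; rewrite <- (cos_shift x).
  unfold Rabs; destruct (Rcase_abs _); [f_equal; ring | ].
  rewrite <- cos_neg; f_equal; ring. }
rewrite !Hs.
assert (Rabs (t - PI / 2) <= PI / 2) by (apply Rabs_le; lra).
pose proof PI_RGT_0.
apply cos_decr_1; try lra; apply Rabs_pos || (pose proof (Rabs_pos (u - PI/2)); lra).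
Qed.

(** The derivative of the sine sum is [sin (2 M v) / (2 sin v)] with [M = K + 1],
    which oscillates but is not small.  The correction
    [corr v = cos (2 M v) / (4 M sin v)] is of order 1/M and its derivative
    cancels the oscillating term; what remains in the derivative of the
    corrected sum is of order 1/M, so the mean value inequality applies. *)
Lemma sin_sum_near_PI2 K t u :
  0 < t < PI -> Rabs (u - PI / 2) <= Rabs (t - PI / 2) ->
  Rabs (sin_sum 1 K u - sin_sum 1 K (PI / 2)) <= / sin t ^ 2 / (INR K + 1).
Proof.
intros Ht Hu.
set (M := INR (S K)).
assert (HM : 1 <= M) by (unfold M; rewrite S_INR; pose proof (pos_INR K); lra).
assert (Hs : 0 < sin t) by (apply sin_gt_0; lra).
assert (Hs1 : sin t <= 1) by apply SIN_bound.
set (corr := fun v => cos (2 * M * v) / (4 * M * sin v)).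
assert (Hcorr : forall v, sin t <= sin v -> Rabs (corr v) <= / (4 * M * sin t)).
{ intros v Hv; unfold corr, Rdiv; rewrite Rabs_mult, (Rabs_right (/ _))
    by (apply Rle_ge, Rlt_le, Rinv_0_lt_compat; nra).
  rewrite <- (Rmult_1_l (/ (4 * M * sin t))).
  apply Rmult_le_compat; [apply Rabs_pos | apply Rlt_le, Rinv_0_lt_compat; nra
    | apply Rabs_le, COS_bound | apply Rinv_le_contravar; nra]. }
assert (Hbv : Rabs ((sin_sum 1 K u + corr u) - (sin_sum 1 K (PI / 2) + corr (PI / 2)))
              <= / (4 * M * sin t ^ 2) * Rabs (u - PI / 2)).
{ apply (bounded_variation (fun v => sin_sum 1 K v + corr v)
           (fun v => - (cos (2 * M * v) * cos v) / (4 * M * sin v ^ 2))).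
  intros v Hv.
  assert (Hsv : sin t <= sin v)
    by (apply sin_le_of_closer_to_PI2; [exact Ht | lra]).
  split.
  - replace (- _ / _) with (cos_sum 0 K v
      + (- (2 * M * sin (2 * M * v)) / (4 * M * sin v)
         - cos (2 * M * v) * cos v / (4 * M * sin v ^ 2))).
    + apply (is_derive_plus (V := R_NormedModule) (sin_sum 1 K) corr).
      * apply is_derive_sin_sum.
      * assert (0 < 4 * M * sin v) by nra.
        unfold corr; auto_derive; [lra | field; lra].
    + replace (cos_sum 0 K v) with (sin (2 * M * v) / (2 * sin v)).
      * field; lra.
      * unfold M; rewrite <- dirichlet_kernel; field; lra.
  - assert (Hsq : 0 < sin t ^ 2 <= sin v ^ 2)
      by (split; [apply pow_lt; lra | apply pow_incr; lra]).
    assert (Hc : Rabs (- (cos (2 * M * v) * cos v)) <= 1).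
    { rewrite Rabs_Ropp, Rabs_mult, <- (Rmult_1_l 1).
      apply Rmult_le_compat; try apply Rabs_pos; apply Rabs_le, COS_bound. }
    unfold Rdiv; rewrite Rabs_mult, (Rabs_right (/ _))
      by (apply Rle_ge, Rlt_le, Rinv_0_lt_compat; nra).
    rewrite <- (Rmult_1_l (/ (4 * M * sin t ^ 2))).
    apply Rmult_le_compat; [apply Rabs_pos | apply Rlt_le, Rinv_0_lt_compat; nra
      | exact Hc | apply Rinv_le_contravar; nra]. }
(* In units of [/ (4 * M * sin t ^ 2)], the increment then counts for two and
   each of the two corrections for one. *)
assert (Hu2 : Rabs (u - PI / 2) <= 2).
{ assert (Rabs (t - PI / 2) <= PI / 2) by (apply Rabs_le; lra).
  pose proof PI_4; lra. }
assert (Hc1 := Hcorr u (sin_le_of_closer_to_PI2 t u Ht Hu)).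
assert (Hc2 : Rabs (corr (PI / 2)) <= / (4 * M * sin t))
  by (apply Hcorr; rewrite sin_PI2; exact Hs1).
assert (Hsq : 0 < sin t ^ 2 <= sin t) by nra.
assert (Hinv : / (4 * M * sin t) <= / (4 * M * sin t ^ 2))
  by (apply Rinv_le_contravar; nra).
assert (Hpos : 0 < / (4 * M * sin t ^ 2)) by (apply Rinv_0_lt_compat; nra).
replace (/ sin t ^ 2 / (INR K + 1)) with (4 * / (4 * M * sin t ^ 2))
  by (unfold M in *; rewrite S_INR in *; field; lra).
apply Rabs_le_between in Hbv, Hc1, Hc2; apply Rabs_le.
nra.
Qed.

(** Adding [PI / 4 * u] to the cosine sum gives a function whose derivative tends
    to 0 uniformly between [t] and [PI / 2], while its value at [PI / 2] does not
    depend on [K]. *)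
Lemma lim_cos_sum_2_interior t :
  0 < t < PI -> is_lim_seq (fun K => cos_sum 2 K t) (PI / 4 * (PI / 2 - t)).
Proof.
intros Ht.
set (e := fun K => / sin t ^ 2 / (INR K + 1)
                   + Rabs (sin_sum 1 K (PI / 2) - PI / 4)).
apply is_lim_seq_squeeze_abs with (v := fun K => e K * Rabs (t - PI / 2)).
- intros K.
  replace (cos_sum 2 K t - PI / 4 * (PI / 2 - t))
    with ((cos_sum 2 K t + PI / 4 * t)
          - (cos_sum 2 K (PI / 2) + PI / 4 * (PI / 2)))
    by (rewrite cos_sum_at_PI2; ring).
  apply (bounded_variation (fun u => cos_sum 2 K u + PI / 4 * u)
           (fun u => - sin_sum 1 K u + PI / 4)).
  intros u Hu; split.
  + apply (is_derive_plus (V := R_NormedModule) (cos_sum 2 K) (fun u => PI / 4 * u)).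
    * apply is_derive_cos_sum.
    * auto_derive; [trivial | ring].
  + pose proof (sin_sum_near_PI2 K t u Ht Hu) as Hn.
    replace (- sin_sum 1 K u + PI / 4)
      with (- ((sin_sum 1 K u - sin_sum 1 K (PI / 2)) + (sin_sum 1 K (PI / 2) - PI / 4)))
      by ring.
    rewrite Rabs_Ropp; eapply Rle_trans; [apply Rabs_triang | ].
    unfold e; lra.
- replace (Finite 0) with (Rbar_mult (0 + 0) (Rabs (t - PI / 2)))
    by (apply Rbar_finite_eq; ring).
  apply (is_lim_seq_mult' e (fun _ => Rabs (t - PI / 2))); [ | apply is_lim_seq_const].
  apply is_lim_seq_plus'; [apply lim_const_div_INR | ].
  rewrite <- Rabs_R0; apply (is_lim_seq_abs _ (Finite 0)).
  replace (Finite 0) with (Finite (PI / 4 - PI / 4)) by (apply Rbar_finite_eq; ring).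
  apply is_lim_seq_minus'; [apply lim_sin_sum_PI2 | apply is_lim_seq_const].
Qed.

(** A crude bound, enough for [Rlambda_0] because the point used there is at
    distance of order [1 / K ^ 2] from 0. *)
Lemma sin_sum_abs_le K t : Rabs (sin_sum 1 K t) <= INR K + 1.
Proof.
unfold sin_sum; induction K as [|K IH].
- rewrite sum_O; unfold odd_num; simpl.
  replace (sin _ / _) with (sin ((2 * 0 + 1) * t)) by field.
  rewrite Rplus_0_l; apply Rabs_le, SIN_bound.
- rewrite Rsum_Sn, S_INR.
  eapply Rle_trans; [apply Rabs_triang | ].
  apply Rplus_le_compat; [exact IH | ].
  pose proof (odd_num_ge1 (S K)) as Ho.
  unfold Rdiv; rewrite Rabs_mult, <- (Rmult_1_l 1).
  apply Rmult_le_compat; try apply Rabs_pos.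
  + apply Rabs_le, SIN_bound.
  + rewrite Rabs_right by (apply Rle_ge, Rlt_le, Rinv_0_lt_compat; lra).
    rewrite <- Rinv_1; apply Rinv_le_contravar; lra.
Qed.

(** The line [PI / 4 * (PI / 2 - t)] is the sum of the cosine series inside the
    interval, and the sum at 0 is its limit by uniform convergence: compare the
    values at 0 and at the points [1 / (K + 1) ^ 2], where the [K]-th partial sum
    has moved by at most [1 / (K + 1)]. *)
Lemma Rlambda_0 : Rlambda 0 = PI ^ 2 / 8.
Proof.
set (t := fun K => / (INR K + 1) ^ 2).
assert (Hlim : is_lim_seq (fun K => 2 * lambda_tail 0 K + 2 * (1 / (INR K + 1))) 0).
{ replace (Finite 0) with (Finite (2 * 0 + 2 * 0)) by (apply Rbar_finite_eq; ring).
  apply is_lim_seq_plus'; apply is_lim_seq_mult'; try apply is_lim_seq_const.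
  - apply lim_lambda_tail.
  - apply lim_const_div_INR. }
assert (H : is_lim_seq (fun _ => PI ^ 2 / 8) (Rlambda 0)).
{ apply is_lim_seq_squeeze_abs with (2 := Hlim).
  intros K; pose proof (pos_INR K) as HK; pose proof PI2_3_2.
  assert (Ht : 0 < t K <= 1).
  { unfold t; split; [apply Rinv_0_lt_compat; nra | ].
    rewrite <- Rinv_1; apply Rinv_le_contravar; nra. }
  assert (HtPI : 0 < t K < PI) by lra.
  pose proof (cos_sum_tail_le 0 K (t K) _ (lim_cos_sum_2_interior _ HtPI)) as H1.
  pose proof (cos_sum_at_0 0 K) as H0.
  change (2 * 0 + 2)%nat with 2%nat in H0, H1.
  assert (Hb : Rabs (cos_sum 2 K (t K) - cos_sum 2 K 0)
               <= (INR K + 1) * Rabs (t K - 0)).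
  { apply bounded_variation with (dh := fun u => - sin_sum 1 K u).
    intros u _; split; [apply is_derive_cos_sum | ].
    rewrite Rabs_Ropp; apply sin_sum_abs_le. }
  rewrite Rminus_0_r, (Rabs_right (t K)) in Hb by lra.
  replace ((INR K + 1) * t K) with (1 / (INR K + 1)) in Hb
    by (unfold t; field; lra).
  assert (HPt : PI / 4 * t K <= 1 / (INR K + 1)).
  { pose proof PI_4.
    apply Rle_trans with (1 * t K); [apply Rmult_le_compat_r; lra | ].
    unfold t, Rdiv; rewrite !Rmult_1_l; apply Rinv_le_contravar; nra. }
  assert (0 < PI / 4 * t K) by (apply Rmult_lt_0_compat; lra).
  apply Rabs_le_between in H1, Hb; apply Rabs_le.
  nra. }
apply is_lim_seq_unique in H; rewrite Lim_seq_const in H.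
apply Rbar_finite_eq in H; lra.
Qed.

(** * The cosine series with coefficients 1/(2n+1)^(2j+2) *)

(** Divided powers: differentiation lowers the index by one, without a
    coefficient. *)
Definition dpow (n : nat) (t : R) : R := t ^ n / INR (fact n).

Lemma dpow_S_0 n : dpow (S n) 0 = 0.
Proof. unfold dpow; simpl; unfold Rdiv; ring. Qed.

Lemma is_derive_dpow_S n t : is_derive (dpow (S n)) t (dpow n t).
Proof.
unfold dpow; pose proof (INR_fact_neq_0 n); pose proof (INR_fact_neq_0 (S n)).
set (c := INR (fact (S n))) in *.
auto_derive; [trivial | ].
change (Init.Nat.pred (S n)) with n; unfold c.
change (match n with O => 1 | S _ => INR n + 1 end) with (INR (S n)).
rewrite fact_simpl, mult_INR.
field; split; [exact H | apply not_0_INR; lia].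
Qed.

(** For [p = 0] this is the closed form on [0, PI] of the cosine series with
    coefficients [1 / (2n+1) ^ (2j+2)]; for larger [p] it is the [p]-th
    antiderivative of that polynomial that vanishes at 0 together with its
    derivatives of order less than [p]. *)
Definition cos_poly (p j : nat) (t : R) : R :=
  sum_n (fun k => (-1) ^ k * Rlambda (j - k) * dpow (2 * k + p) t) j
  + (-1) ^ S j * (PI / 4) * dpow (2 * j + 1 + p) t.

Lemma is_derive_cos_poly_S p j t : is_derive (cos_poly (S p) j) t (cos_poly p j t).
Proof.
unfold cos_poly.
apply (is_derive_plus (V := R_NormedModule)
  (fun t => sum_n (fun k => (-1) ^ k * Rlambda (j - k) * dpow (2 * k + S p) t) j)).
- apply (is_derive_sum_n (V := R_NormedModule)
    (fun k t => (-1) ^ k * Rlambda (j - k) * dpow (2 * k + S p) t)).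
  intros k _; rewrite Nat.add_succ_r.
  apply is_derive_scal, is_derive_dpow_S.
- rewrite Nat.add_succ_r.
  apply is_derive_scal, is_derive_dpow_S.
Qed.

Lemma cos_poly_S_at_0 p j : cos_poly (S p) j 0 = 0.
Proof.
unfold cos_poly; rewrite Nat.add_succ_r, dpow_S_0.
rewrite (sum_n_ext _ (fun _ => 0)).
- rewrite sum_n_const; ring.
- intros k; rewrite Nat.add_succ_r, dpow_S_0; real_eq; ring.
Qed.

(** The second derivative of [cos_poly 0 (S j)] is [- cos_poly 0 j]; the constant
    of integration is the value of the cosine series at 0. *)
Lemma cos_poly_0_S j t : cos_poly 0 (S j) t = Rlambda (S j) - cos_poly 2 j t.
Proof.
unfold cos_poly; rewrite Rsum_Sn_first.
rewrite (sum_n_ext (fun k => (-1) ^ S k * _ * _)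
  (fun k => - ((-1) ^ k * Rlambda (j - k) * dpow (2 * k + 2) t))).
- rewrite Rsum_opp.
  replace (2 * S j + 1 + 0)%nat with (2 * j + 1 + 2)%nat by lia.
  replace (S j - 0)%nat with (S j) by lia.
  replace (dpow (2 * 0 + 0) t) with 1 by (unfold dpow; simpl; field).
  simpl pow; ring.
- intros k; replace (2 * S k + 0)%nat with (2 * k + 2)%nat by lia.
  replace (S j - S k)%nat with (j - k)%nat by lia.
  simpl pow; real_eq; ring.
Qed.

Lemma lim_cos_sum_at_0 j : is_lim_seq (fun K => cos_sum (2 * j + 2) K 0) (Rlambda j).
Proof.
apply is_lim_seq_ext with (fun K => Rlambda j - lambda_tail j K).
- intros K; symmetry; apply cos_sum_at_0.
- replace (Finite (Rlambda j)) with (Finite (Rlambda j - 0))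
    by (apply Rbar_finite_eq; ring).
  apply is_lim_seq_minus'; [apply is_lim_seq_const | apply lim_lambda_tail].
Qed.

Lemma lim_cos_sum_at_PI j : is_lim_seq (fun K => cos_sum (2 * j + 2) K PI) (- Rlambda j).
Proof.
apply is_lim_seq_ext with (fun K => - cos_sum (2 * j + 2) K 0).
- intros K; symmetry; apply cos_sum_at_PI.
- apply (is_lim_seq_opp _ (Finite (Rlambda j))), lim_cos_sum_at_0.
Qed.

Lemma lim_cos_sum_2 t :
  0 <= t <= PI -> is_lim_seq (fun K => cos_sum 2 K t) (cos_poly 0 0 t).
Proof.
intros Ht.
replace (cos_poly 0 0 t) with (PI / 4 * (PI / 2 - t)).
- destruct (Req_dec t 0) as [-> | H0].
  { replace (PI / 4 * (PI / 2 - 0)) with (Rlambda 0) by (rewrite Rlambda_0; field).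
    apply lim_cos_sum_at_0. }
  destruct (Req_dec t PI) as [-> | HPI].
  { replace (PI / 4 * (PI / 2 - PI)) with (- Rlambda 0) by (rewrite Rlambda_0; field).
    apply lim_cos_sum_at_PI. }
  apply lim_cos_sum_2_interior; lra.
- unfold cos_poly; rewrite sum_O; simpl Nat.sub; rewrite Rlambda_0.
  unfold dpow; simpl; field.
Qed.

(** Induction on [j].  The second derivatives of the sums with exponent [2j+4] are,
    up to sign, the sums with exponent [2j+2], which are uniformly close to
    [cos_poly 0 j]; integrating twice from 0 preserves this closeness. *)
Lemma lim_cos_sum j t :
  0 <= t <= PI -> is_lim_seq (fun K => cos_sum (2 * j + 2) K t) (cos_poly 0 j t).
Proof.
revert t; induction j as [|j IH]; [exact lim_cos_sum_2 | ].
intros t Ht.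
apply is_lim_seq_squeeze_abs
  with (v := fun K => lambda_tail j K * t ^ 2 + lambda_tail (S j) K).
- intros K.
  assert (H : Rabs ((cos_sum (2 * S j + 2) K t + cos_poly 2 j t)
                    - (cos_sum (2 * S j + 2) K 0 + cos_poly 2 j 0)) <= lambda_tail j K * t ^ 2).
  { apply (increment_le_second (fun u => cos_sum (2 * S j + 2) K u + cos_poly 2 j u)
             (fun u => - sin_sum (2 * j + 3) K u + cos_poly 1 j u)
             (fun u => - cos_sum (2 * j + 2) K u + cos_poly 0 j u)).
    - lra.
    - rewrite sin_sum_at_0, cos_poly_S_at_0; ring.
    - intros u _.
      apply (is_derive_plus (V := R_NormedModule) (cos_sum (2 * S j + 2) K) (cos_poly 2 j)).
      + replace (2 * S j + 2)%nat with (S (2 * j + 3)) by lia.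
        apply is_derive_cos_sum.
      + apply is_derive_cos_poly_S.
    - intros u Hu; split.
      + apply (is_derive_plus (V := R_NormedModule)
          (fun u => - sin_sum (2 * j + 3) K u) (cos_poly 1 j)).
        * replace (2 * j + 3)%nat with (S (2 * j + 2)) by lia.
          apply (is_derive_opp (V := R_NormedModule)), is_derive_sin_sum.
        * apply is_derive_cos_poly_S.
      + replace (- _ + _) with (- (cos_sum (2 * j + 2) K u - cos_poly 0 j u)) by ring.
        rewrite Rabs_Ropp; apply cos_sum_tail_le, IH; lra. }
  rewrite cos_poly_S_at_0 in H.
  pose proof (cos_sum_tail_le (S j) K 0 _ (lim_cos_sum_at_0 (S j))) as H0.
  rewrite cos_poly_0_S.
  apply Rabs_le_between in H, H0; apply Rabs_le; lra.
- replace (Finite 0) with (Finite (0 * t ^ 2 + 0)) by (apply Rbar_finite_eq; ring).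
  apply is_lim_seq_plus'; [ | apply lim_lambda_tail].
  apply is_lim_seq_mult'; [apply lim_lambda_tail | apply is_lim_seq_const].
Qed.

(** At [PI] all cosines of the series equal -1, so that its sum is minus that
    at 0. *)
Lemma Rlambda_recurrence j : cos_poly 0 j PI = - Rlambda j.
Proof.
pose proof PI_RGT_0.
apply Rbar_finite_eq.
rewrite <- (is_lim_seq_unique _ _ (lim_cos_sum j PI ltac:(lra))).
apply is_lim_seq_unique, lim_cos_sum_at_PI.
Qed.

(** * Complex sums and the binomial theorem *)

Open Scope C_scope.

Ltac complex_eq := lazymatch goal with |- @eq _ ?a ?b => change (@eq C a b) end.

Lemma Csum_Sn (a : nat -> C) n : sum_n a (S n) = sum_n a n + a (S n).
Proof. exact (sum_Sn a n). Qed.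

Lemma Csum_plus (a b : nat -> C) n :
  sum_n (fun k => a k + b k) n = sum_n a n + sum_n b n.
Proof. exact (sum_n_plus a b n). Qed.

Lemma Csum_mult_l c (a : nat -> C) n :
  sum_n (fun k => c * a k) n = c * sum_n a n.
Proof. exact (sum_n_mult_l (K := C_Ring) c a n). Qed.

Lemma Csum_Sn_first (a : nat -> C) n :
  sum_n a (S n) = a O + sum_n (fun k => a (S k)) n.
Proof.
induction n as [|n IH]; [now rewrite Csum_Sn, !sum_O | ].
rewrite Csum_Sn, IH, Csum_Sn; complex_eq; ring.
Qed.

(** Summation over the triangle [i + j <= m], by diagonals and by rows. *)
Lemma Csum_triangle (F : nat -> nat -> C) m :
  sum_n (fun k => sum_n (fun i => F i (k - i)%nat) k) m
  = sum_n (fun i => sum_n (F i) (m - i)%nat) m.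
Proof.
induction m as [|m IH]; [now rewrite !sum_O | ].
rewrite Csum_Sn, IH, !Csum_Sn.
rewrite (sum_n_ext_loc (fun i => sum_n (F i) (S m - i))
  (fun i => sum_n (F i) (m - i) + F i (S m - i)%nat)).
- rewrite Csum_plus, Nat.sub_diag, sum_O; complex_eq; ring.
- intros i Hi; replace (S m - i)%nat with (S (m - i)) by lia.
  apply Csum_Sn.
Qed.

Lemma Csum_even_terms (f : nat -> C) k :
  (forall i, (i < k)%nat -> f (2 * i + 1)%nat = 0) ->
  sum_n f (2 * k) = sum_n (fun i => f (2 * i)%nat) k.
Proof.
induction k as [|k IH]; intros Hf; [now rewrite !sum_O | ].
replace (2 * S k)%nat with (S (S (2 * k))) by lia.
rewrite !Csum_Sn, IH by (intros; apply Hf; lia).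
replace (S (2 * k)) with (2 * k + 1)%nat by lia.
rewrite Hf by lia.
replace (2 * S k)%nat with (S (2 * k + 1)) by lia.
complex_eq; ring.
Qed.

Definition Cdpow (n : nat) (z : C) : C := z ^ n / RtoC (INR (fact n)).

Lemma RtoC_INR_neq0 n : n <> O -> RtoC (INR n) <> 0.
Proof. intros Hn H; apply RtoC_inj in H; exact (not_0_INR n Hn H). Qed.

(** The factor [INR (S n)] is kept on the left, so that [Cdpow_plus] follows by
    multiplying its right side by [n + 1]. *)
Lemma Cdpow_S n z : RtoC (INR (S n)) * Cdpow (S n) z = z * Cdpow n z.
Proof.
unfold Cdpow; rewrite Cpow_S, fact_simpl, mult_INR, RtoC_mult.
field; split; apply RtoC_INR_neq0; [apply fact_neq_0 | discriminate].
Qed.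

Lemma Cdpow_mult n x z : Cdpow n (x * z) = z ^ n * (x ^ n / RtoC (INR (fact n))).
Proof. unfold Cdpow, Cdiv; rewrite Cpow_mult_l; ring. Qed.

(** The binomial theorem.  With [INR (S n)] written as [i + (S n - i)], each term
    of the convolution of order [S n] splits, by [Cdpow_S], into [a] times a term
    and [b] times a term of the convolution of order [n]. *)
Lemma Cdpow_plus n a b :
  Cdpow n (a + b) = sum_n (fun i => Cdpow i a * Cdpow (n - i) b) n.
Proof.
induction n as [|n IH].
- rewrite sum_O; unfold Cdpow; simpl; field.
- assert (HS : RtoC (INR (S n)) <> 0) by (apply RtoC_INR_neq0; discriminate).
  assert (H : RtoC (INR (S n)) * Cdpow (S n) (a + b)
    = RtoC (INR (S n)) * sum_n (fun i => Cdpow i a * Cdpow (S n - i) b) (S n)).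
  { rewrite Cdpow_S, IH, <- (Csum_mult_l (RtoC (INR (S n)))).
    rewrite (sum_n_ext_loc (fun k => RtoC (INR (S n)) * _)
      (fun i => RtoC (INR i) * Cdpow i a * Cdpow (S n - i) b
                + Cdpow i a * (RtoC (INR (S n - i)) * Cdpow (S n - i) b))).
    - rewrite Csum_plus, Csum_Sn_first, (Csum_Sn (fun i => Cdpow i a * _)).
      rewrite Nat.sub_diag.
      rewrite (sum_n_ext (fun k => RtoC (INR (S k)) * _ * _)
        (fun i => a * (Cdpow i a * Cdpow (n - i) b))).
      2: { intros i; rewrite Cdpow_S; replace (S n - S i)%nat with (n - i)%nat by lia.
           complex_eq; ring. }
      rewrite (sum_n_ext_loc (fun i => Cdpow i a * (RtoC _ * _))
        (fun i => b * (Cdpow i a * Cdpow (n - i) b))).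
      2: { intros i Hi; replace (S n - i)%nat with (S (n - i)) by lia.
           rewrite Cdpow_S; complex_eq; ring. }
      (* The two boundary terms carry the factors [INR 0]. *)
      rewrite !Csum_mult_l; simpl INR; complex_eq; ring.
    - intros i Hi.
      rewrite minus_INR, RtoC_minus by exact Hi; complex_eq; ring. }
  rewrite <- (Cmult_1_l (Cdpow _ _)), <- (Cinv_l _ HS), <- Cmult_assoc, H.
  rewrite Cmult_assoc, Cinv_l by exact HS; complex_eq; ring.
Qed.

Lemma Cdpow_opp_even n z : Cdpow (2 * n) (- z) = Cdpow (2 * n) z.
Proof.
unfold Cdpow; f_equal; rewrite !Cpow_mult_r; f_equal; ring.
Qed.

Lemma Cdpow_opp_odd n z : Cdpow (2 * n + 1) (- z) = - Cdpow (2 * n + 1) z.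
Proof.
unfold Cdpow, Cdiv; rewrite !Cpow_add_r, !Cpow_mult_r, !Cpow_1_r.
replace ((- z) ^ 2) with (z ^ 2) by ring; ring.
Qed.

Lemma Cdpow_even_part k a b :
  Cdpow (2 * k) (a + b) + Cdpow (2 * k) (a - b)
  = 2 * sum_n (fun i => Cdpow (2 * i) a * Cdpow (2 * (k - i)) b) k.
Proof.
unfold Cminus; rewrite !Cdpow_plus, <- Csum_plus, Csum_even_terms.
- rewrite <- Csum_mult_l; apply sum_n_ext; intros i.
  replace (2 * k - 2 * i)%nat with (2 * (k - i))%nat by lia.
  rewrite Cdpow_opp_even; complex_eq; ring.
- intros i Hi; replace (2 * k - (2 * i + 1))%nat with (2 * (k - i - 1) + 1)%nat by lia.
  rewrite Cdpow_opp_odd; ring.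
Qed.

Lemma Cdpow_odd_part k a b :
  Cdpow (2 * k + 1) (a + b) - Cdpow (2 * k + 1) (a - b)
  = 2 * sum_n (fun i => Cdpow (2 * i) a * Cdpow (2 * (k - i) + 1) b) k.
Proof.
set (f := fun i => Cdpow i a * (Cdpow (2 * k + 1 - i) b - Cdpow (2 * k + 1 - i) (- b))).
assert (Hodd : forall i, (i <= k)%nat -> f (2 * i + 1)%nat = 0).
{ intros i Hi; unfold f.
  replace (2 * k + 1 - (2 * i + 1))%nat with (2 * (k - i))%nat by lia.
  rewrite Cdpow_opp_even; ring. }
transitivity (sum_n f (2 * k + 1)).
- rewrite (sum_n_ext f (fun i => Cdpow i a * Cdpow (2 * k + 1 - i) b
    + RtoC (-1) * (Cdpow i a * Cdpow (2 * k + 1 - i) (- b)))).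
  + unfold Cminus; rewrite Csum_plus, Csum_mult_l, !Cdpow_plus; complex_eq; ring.
  + intros i; unfold f; complex_eq; ring.
(* The last index is odd, so its term vanishes. *)
- rewrite (Nat.add_1_r (2 * k)), Csum_Sn, <- (Nat.add_1_r (2 * k)), (Hodd k) by lia.
  rewrite Csum_even_terms by (intros; apply Hodd; lia).
  rewrite Cplus_0_r, <- Csum_mult_l; apply sum_n_ext_loc; intros i Hi; unfold f.
  replace (2 * k + 1 - 2 * i)%nat with (2 * (k - i) + 1)%nat by lia.
  rewrite Cdpow_opp_odd; complex_eq; ring.
Qed.

(** * From the recurrence to the identity *)

(** Expanded in powers of [a] with the even and odd parts of the binomial theorem,
    the left side is the sum over [i <= m] of [2 * (-1) ^ i * Cdpow (2 * i) a] times
    the difference of the two sides of the hypothesis for [j = m - i].  The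
    hypothesis for [j] is half the identity for [m = j] and [a = 0]. *)
Lemma identity_from_value_at_0 (L : nat -> C) (p c a : C) m :
  (forall j, sum_n (fun k => RtoC (-1) ^ k * Cdpow (2 * k) p * L (j - k)%nat) j + L j
             = RtoC (-1) ^ j * c * Cdpow (2 * j + 1) p) ->
  RtoC (-1) ^ m * c * (Cdpow (2 * m + 1) (a - p) - Cdpow (2 * m + 1) (a + p))
  + sum_n (fun k => RtoC (-1) ^ k
      * (Cdpow (2 * k) (a - p) + Cdpow (2 * k) (a + p) + 2 * Cdpow (2 * k) a)
      * L (m - k)%nat) m = 0.
Proof.
intros HL.
replace (Cdpow (2 * m + 1) (a - p) - Cdpow (2 * m + 1) (a + p))
  with (- (2 * sum_n (fun i => Cdpow (2 * i) a * Cdpow (2 * (m - i) + 1) p) m))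
  by (rewrite <- Cdpow_odd_part; ring).
rewrite (sum_n_ext (fun k => RtoC (-1) ^ k * (_ + _ + _) * L _)
  (fun k => 2 * (sum_n (fun i => RtoC (-1) ^ k * L (m - k)%nat
                 * (Cdpow (2 * i) a * Cdpow (2 * (k - i)) p)) k
            + RtoC (-1) ^ k * Cdpow (2 * k) a * L (m - k)%nat))).
2: { intros k.
     rewrite Csum_mult_l, (Cplus_comm (Cdpow _ (a - p))), Cdpow_even_part.
     complex_eq; ring. }
rewrite Csum_mult_l, Csum_plus.
set (F := fun i j => RtoC (-1) ^ i * Cdpow (2 * i) a
    * (RtoC (-1) ^ j * Cdpow (2 * j) p * L (m - i - j)%nat)).
rewrite (sum_n_ext (fun k => sum_n _ k) (fun k => sum_n (fun i => F i (k - i)%nat) k)).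
2: { intros k; apply sum_n_ext_loc; intros i Hi; unfold F.
     replace (RtoC (-1) ^ k) with (RtoC (-1) ^ i * RtoC (-1) ^ (k - i))
       by (rewrite <- Cpow_add_r; f_equal; lia).
     replace (m - i - (k - i))%nat with (m - k)%nat by lia.
     complex_eq; ring. }
rewrite (Csum_triangle F), <- Csum_plus.
rewrite (sum_n_ext_loc (fun k => sum_n _ (m - k) + _)
  (fun i => RtoC (-1) ^ m * c * (Cdpow (2 * i) a * Cdpow (2 * (m - i) + 1) p))).
- rewrite Csum_mult_l; ring.
- intros i Hi; unfold F.
  rewrite Csum_mult_l.
  transitivity (RtoC (-1) ^ i * Cdpow (2 * i) a *
    (sum_n (fun j => RtoC (-1) ^ j * Cdpow (2 * j) p * L (m - i - j)%nat) (m - i)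
     + L (m - i)%nat)); [complex_eq; ring | ].
  rewrite HL.
  replace (RtoC (-1) ^ m) with (RtoC (-1) ^ i * RtoC (-1) ^ (m - i))
    by (rewrite <- Cpow_add_r; f_equal; lia).
  complex_eq; ring.
Qed.

Lemma RtoC_sum (a : nat -> R) N : RtoC (sum_n a N) = sum_n (fun n => RtoC (a n)) N.
Proof.
induction N as [|N IH]; [now rewrite !sum_O | ].
now rewrite Rsum_Sn, Csum_Sn, RtoC_plus, IH.
Qed.

Lemma is_series_RtoC (a : nat -> R) (l : R) :
  is_series a l -> is_series (fun n => RtoC (a n)) (RtoC l).
Proof.
intros H; unfold is_series.
apply filterlim_ext with (fun N => RtoC (sum_n a N)); [apply RtoC_sum | ].
apply (filterlim_comp _ _ _ (sum_n a) RtoC _ _ _ H).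
apply filterlim_locally; intros eps; exists eps; intros y Hy.
split; [exact Hy | apply ball_center].
Qed.

Lemma lambda_even j : lambda (RtoC (2 * INR j + 2)) = RtoC (Rlambda j).
Proof.
apply lambda_unique.
apply is_series_ext with (fun n => RtoC (/ odd_num n ^ (2 * j + 2))).
- intros n; pose proof (odd_num_ge1 n); pose proof (odd_num_pow_gt0 n (2 * j + 2)).
  unfold lambda_term, RCpower, Cexp.
  change (2 * INR n + 1)%R with (odd_num n).
  rewrite <- RtoC_mult; simpl Re; simpl Im.
  rewrite cos_0, sin_0.
  replace (2 * INR j + 2)%R with (INR (2 * j + 2))
    by (rewrite plus_INR, mult_INR; reflexivity).
  change (exp (INR (2 * j + 2) * ln (odd_num n)))
    with (Rpower (odd_num n) (INR (2 * j + 2))).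
  rewrite Rpower_pow by lra.
  rewrite Cmult_0_r, Cplus_0_r, Cmult_1_r, RtoC_inv by lra; reflexivity.
- apply is_series_RtoC, Series_correct, ex_series_lambda.
Qed.

Lemma RtoC_dpow n t : RtoC (dpow n t) = Cdpow n (RtoC t).
Proof. unfold dpow, Cdpow; rewrite RtoC_div, RtoC_pow by apply INR_fact_neq_0; reflexivity. Qed.

Lemma Clambda_recurrence j :
  sum_n (fun k => RtoC (-1) ^ k * Cdpow (2 * k) (RtoC PI) * RtoC (Rlambda (j - k))) j
  + RtoC (Rlambda j)
  = RtoC (-1) ^ j * RtoC (PI / 4) * Cdpow (2 * j + 1) (RtoC PI).
Proof.
rewrite (sum_n_ext _ (fun k => RtoC ((-1) ^ k * Rlambda (j - k) * dpow (2 * k + 0) PI))).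
- rewrite <- RtoC_sum, <- RtoC_dpow, <- RtoC_pow, <- RtoC_plus, <- !RtoC_mult.
  f_equal.
  pose proof (Rlambda_recurrence j) as H; unfold cos_poly in H.
  rewrite (Nat.add_0_r (2 * j + 1)) in H; simpl pow in H; lra.
- intros k; rewrite Nat.add_0_r, !RtoC_mult, RtoC_pow, RtoC_dpow.
  complex_eq; ring.
Qed.

Theorem theorem1p9 (m : nat) (alpha : C) :
  RtoC (-1) ^ m
  * (RtoC PI ^ (2 * m + 2) / (RtoC 4 * RtoC (INR (fact (2 * m + 1)))))
  * ((alpha - RtoC 1) ^ (2 * m + 1) - (alpha + RtoC 1) ^ (2 * m + 1))
  + sum_n (fun k : nat =>
      RtoC (-1) ^ k
      * ((alpha - RtoC 1) ^ (2 * k) + (alpha + RtoC 1) ^ (2 * k)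
         + RtoC 2 * alpha ^ (2 * k))
      * (RtoC PI ^ (2 * k) / RtoC (INR (fact (2 * k))))
      * lambda (RtoC (2 * INR m - 2 * INR k + 2)%R)) m
  = RtoC 0.
Proof.
rewrite <- (identity_from_value_at_0 (fun j => RtoC (Rlambda j)) (RtoC PI)
  (RtoC (PI / 4)) (RtoC PI * alpha) m Clambda_recurrence).
replace (RtoC PI * alpha - RtoC PI) with (RtoC PI * (alpha - RtoC 1)) by ring.
replace (RtoC PI * alpha + RtoC PI) with (RtoC PI * (alpha + RtoC 1)) by ring.
f_equal.
- rewrite !Cdpow_mult.
  replace (2 * m + 2)%nat with (S (2 * m + 1)) by lia.
  rewrite Cpow_S, RtoC_div by lra.
  field.
  apply RtoC_INR_neq0, fact_neq_0.
- apply sum_n_ext_loc; intros k Hk.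
  replace (2 * INR m - 2 * INR k + 2)%R with (2 * INR (m - k) + 2)%R
    by (rewrite minus_INR by exact Hk; ring).
  rewrite lambda_even, !Cdpow_mult.
  complex_eq; ring.
Qed.
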